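(* Let $D\in\mathbb{R}^{n\times n}$. The optimal solution $R^*\in SO(n)$ to the optimization $$\max_{R\in\mathrm{conv}(SO(n))}\langle D,R\rangle$$ is given by $$R^*=\mathcal{A}(\mu\mu^\top),$$ where $\mu$ is the orthonormal (i.e. unit-norm) eigenvector corresponding to the largest eigenvalue $\nu$ of $\mathcal{A}^\dagger(D)$.
   Context: $SO(n)=\{R\in\mathbb{R}^{n\times n}: R^\top R=I,\ \det R=1\}$, $\mathrm{conv}$ denotes convex hull, $\langle A,B\rangle=\mathrm{trace}(A^\top B)$, and $\mathbb{S}^m$ is the space of real symmetric $m\times m$ matrices. Put $I_2=\begin{bmatrix}1&0\\0&1\end{bmatrix}$, $\sigma=\begin{bmatrix}1&0\\0&-1\end{bmatrix}$, $J=\begin{bmatrix}0&-1\\1&0\end{bmatrix}$. For $1\le i\le n$ define the $2^n\times2^n$ matrices $$\lambda_i=\sigma^{\otimes(i-1)}\otimes J\otimes I_2^{\otimes(n-i)},\qquad \rho_i=I_2^{\otimes(i-1)}\otimes J\otimes\sigma^{\otimes(n-i)},$$ and the $2^n\times 2^{n-1}$ matrix $$P_{\mathrm{even}}=\frac12\begin{bmatrix}I+\sigma^{\otimes(n-1)}\\ I-\sigma^{\otimes(n-1)}\end{bmatrix},$$ with $I$ the identity of size $2^{n-1}$. Let $A_{ij}=-P_{\mathrm{even}}^\top\lambda_i\rho_jP_{\mathrm{even}}\in\mathbb{S}^{2^{n-1}}$. Define $\mathcal{A}:\mathbb{S}^{2^{n-1}}\to\mathbb{R}^{n\times n}$ by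 $\mathcal{A}(Z)_{ij}=\langle A_{ij},Z\rangle$, and let $\mathcal{A}^\dagger:\mathbb{R}^{n\times n}\to\mathbb{S}^{2^{n-1}}$, $\mathcal{A}^\dagger(Y)=\sum_{i,j}A_{ij}Y_{ij}$, be its adjoint. Known fact (Saunderson, Parrilo, Willsky), which may be used: $\mathrm{conv}(SO(n))=\{\mathcal{A}(Z): Z\in\mathbb{S}^{2^{n-1}},\ Z\succeq0,\ \mathrm{trace}(Z)=1\}$.
   Formalization: If ν is a multiple eigenvalue, A(μμᵀ) may fail to lie in SO(n) (n=4, D=0); so membership in SO(n) and uniqueness are stated for simple ν. For every D: each such μ gives an optimum over conv(SO(n)), one exists in SO(n), and each optimum in SO(n) is A(μμᵀ) for some μ. *)

(* Defs.v *)
From mathcomp Require Import all_boot all_order all_algebra.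
From mathcomp Require Import mxtens.
From mathcomp Require Import boolp classical_sets reals.

Set Implicit Arguments.
Unset Strict Implicit.
Unset Printing Implicit Defensive.

Import Order.TTheory GRing.Theory Num.Theory.

Local Open Scope classical_set_scope.
Local Open Scope ring_scope.

Section Convexity.
Variable R : realType.

Definition conv_hull (V : lmodType R) (S : set V) : set V :=
  [set x | exists (k : nat) (w : 'I_k -> R) (y : 'I_k -> V),
    [/\ forall i, 0 <= w i, \sum_(i < k) w i = 1, forall i, S (y i)
      & x = \sum_(i < k) w i *: y i]].

Definition SO (n : nat) : set 'M[R]_n :=
  [set Q | Q^T *m Q = 1%:M /\ \det Q = 1].

Definition mxdot (m n : nat) (A B : 'M[R]_(m, n)) : R := \tr (A^T *m B).

Definition psd (n : nat) (Z : 'M[R]_n) : Prop :=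
  Z^T = Z /\ forall x : 'cV[R]_n, 0 <= \tr (x^T *m Z *m x).

Definition optimal (n : nat) (D Rs : 'M[R]_n) : Prop :=
  conv_hull (@SO n) Rs /\
  forall X, conv_hull (@SO n) X -> mxdot D X <= mxdot D Rs.

(* The library's [eigenvalue] is about row vectors; this makes no difference
   here, as it is only used for symmetric matrices. *)
Definition largest_eigenvalue (n : nat) (M : 'M[R]_n) (nu : R) : Prop :=
  eigenvalue M nu /\ forall a, eigenvalue M a -> a <= nu.

Definition unit_eigenvector (n : nat) (M : 'M[R]_n) (nu : R) (mu : 'cV[R]_n) :
  Prop := M *m mu = nu *: mu /\ mu^T *m mu = 1%:M.

End Convexity.

(* The dimension is n.+1 throughout, so that 2 ^ n is the size of the matrices
   A_ij.  Indices i : 'I_n.+1 are counted from 0: i stands for i + 1. *)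
Section Spin.
Variable R : realType.

Definition mx2 (a b c d : R) : 'M[R]_2 :=
  \matrix_(i < 2, j < 2) nth 0 (nth [::] [:: [:: a; b]; [:: c; d]] i) j.

Definition I2 : 'M[R]_2 := mx2 1 0
                               0 1.
Definition sigma2 : 'M[R]_2 := mx2 1 0
                                   0 (- 1).
Definition J2 : 'M[R]_2 := mx2 0 (- 1)
                               1 0.

Lemma tens_dim (n : nat) (i : 'I_n.+1) :
  (2 ^ i * 2 * 2 ^ (n - i) = 2 ^ n.+1)%N.
Proof.
by rewrite -expnSr -expnD addSn subnKC // -ltnS ltn_ord.
Qed.

Lemma stack_dim (n : nat) : (2 ^ n + 2 ^ n = 2 ^ n.+1)%N.
Proof. by rewrite addnn -mul2n -expnS. Qed.

Definition lambda_mx (n : nat) (i : 'I_n.+1) : 'M[R]_(2 ^ n.+1) :=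
  castmx (tens_dim i, tens_dim i) (sigma2 ^t i *t J2 *t I2 ^t (n - i)).

Definition rho_mx (n : nat) (i : 'I_n.+1) : 'M[R]_(2 ^ n.+1) :=
  castmx (tens_dim i, tens_dim i) (I2 ^t i *t J2 *t sigma2 ^t (n - i)).

Definition P_even (n : nat) : 'M[R]_(2 ^ n.+1, 2 ^ n) :=
  castmx (stack_dim n, erefl (2 ^ n)%N)
    (2^-1 *: col_mx (1%:M + sigma2 ^t n) (1%:M - sigma2 ^t n)).

Definition A_mx (n : nat) (i j : 'I_n.+1) : 'M[R]_(2 ^ n) :=
  - ((P_even n)^T *m lambda_mx i *m rho_mx j *m P_even n).

Definition calA (n : nat) (Z : 'M[R]_(2 ^ n)) : 'M[R]_n.+1 :=
  \matrix_(i, j) mxdot (A_mx i j) Z.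

Definition calA_adj (n : nat) (Y : 'M[R]_n.+1) : 'M[R]_(2 ^ n) :=
  \sum_(i < n.+1) \sum_(j < n.+1) Y i j *: A_mx i j.

End Spin.

Arguments SO R n : clear implicits.

(* Main.v *)
(* Since <D, A(Z)> = <M, Z> for M := A^dagger(D), the maximum over conv(SO(n)) is
   the maximum of <M, Z> over the spectrahedron Z >= 0, tr Z = 1.  As M is
   symmetric, nu I - M >= 0, so that maximum is nu, and writing Z as a sum of
   v_k v_k^T shows that it is attained exactly when every v_k lies in the
   nu-eigenspace of M.  A rotation is an extreme point of conv(SO(n)), because
   SO(n) lies on a Frobenius sphere; so an optimal rotation, being a convex
   combination of the A(v_k v_k^T) / |v_k|^2, equals each of them.  Symmetry of M
   is checked factor by factor on the tensor product lambda_i rho_j. *)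
Require Import Defs.
From mathcomp Require Import all_boot all_order all_algebra.
From mathcomp Require Import mxtens.
From mathcomp Require Import boolp classical_sets reals.
From mathcomp Require Import ring lra zify.

Set Implicit Arguments.
Unset Strict Implicit.
Unset Printing Implicit Defensive.

Import Order.TTheory GRing.Theory Num.Theory.

Local Open Scope classical_set_scope.
Local Open Scope ring_scope.

(** * Tensor products of square matrices, up to casts *)

(* Square matrices with their size, so that tensor products can be compared
   without the casts that associativity introduces. *)
Definition sqmx (R : nzRingType) (m : nat) (A : 'M[R]_m) : {k : nat & 'M[R]_k} :=
  Tagged (fun k => 'M[R]_k) A.

Lemma sqmx_cast (R : nzRingType) (m p : nat) (e e' : m = p) (A : 'M[R]_m) :
  sqmx (castmx (e, e') A) = sqmx A.
Proof. by case: p / e e' => e'; rewrite castmx_id. Qed.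

Lemma castmx_mulmx (R : nzRingType) (m p : nat) (e : m = p) (A B : 'M[R]_m) :
  castmx (e, e) A *m castmx (e, e) B = castmx (e, e) (A *m B).
Proof. by case: p / e; rewrite !castmx_id. Qed.

Lemma sqmx_inj (R : nzRingType) (m : nat) (A B : 'M[R]_m) :
  sqmx A = sqmx B -> A = B.
Proof. by move/eqP; rewrite eq_Tagged => /eqP. Qed.

Lemma sqmx_entries (R : nzRingType) (m p : nat) (A : 'M[R]_m) (B : 'M[R]_p)
    (e : m = p) :
  (forall i j, A i j = B (cast_ord e i) (cast_ord e j)) -> sqmx A = sqmx B.
Proof.
case: p / e B => B eqAB; congr (sqmx _); apply/matrixP => i j.
by rewrite eqAB !cast_ord_id.
Qed.

Lemma sqmx_tens (R : nzRingType) (m m' p p' : nat) (A : 'M[R]_m) (A' : 'M[R]_m')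
    (B : 'M[R]_p) (B' : 'M[R]_p') :
  sqmx A = sqmx A' -> sqmx B = sqmx B' -> sqmx (A *t B) = sqmx (A' *t B').
Proof.
move=> eA eB; have em : m = m' by exact: (congr1 (@tag _ _) eA).
have ep : p = p' by exact: (congr1 (@tag _ _) eB).
by subst m' p'; rewrite (sqmx_inj eA) (sqmx_inj eB).
Qed.

Lemma sqmx_tensA (R : nzRingType) (m p q : nat) (A : 'M[R]_m) (B : 'M[R]_p)
    (C : 'M[R]_q) :
  sqmx (A *t B *t C) = sqmx (A *t (B *t C)).
Proof.
apply: (@sqmx_entries _ _ _ _ _ (esym (mulnA m p q))) => i j.
case: (mxtens_indexP i) => i' i3; case: (mxtens_indexP i') => i1 i2.
case: (mxtens_indexP j) => j' j3; case: (mxtens_indexP j') => j1 j2.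
have castE (a : 'I_m) (b : 'I_p) (c : 'I_q) :
    cast_ord (esym (mulnA m p q)) (mxtens_index (mxtens_index (a, b), c)) =
    mxtens_index (a, mxtens_index (b, c)).
  (* Both indices are the number [(a * p + b) * q + c]. *)
  by apply: val_inj => /=; rewrite mulnDl -mulnA addnA.
by rewrite !castE !tensmxE mulrA.
Qed.

Lemma sqmx_tens1 (R : nzRingType) (m : nat) (A : 'M[R]_m) :
  sqmx (A *t (1%:M : 'M_1)) = sqmx A.
Proof.
apply: (@sqmx_entries _ _ _ _ _ (muln1 m)) => i j.
case: (mxtens_indexP i) => i1 i2; case: (mxtens_indexP j) => j1 j2.
rewrite tensmxE !ord1 mxE mulr1; congr (A _ _); apply: val_inj => /=;
  by rewrite muln1 addn0.
Qed.

Lemma sqmx_1tens (R : nzRingType) (m : nat) (A : 'M[R]_m) :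
  sqmx ((1%:M : 'M_1) *t A) = sqmx A.
Proof.
apply: (@sqmx_entries _ _ _ _ _ (mul1n m)) => i j.
case: (mxtens_indexP i) => i1 i2; case: (mxtens_indexP j) => j1 j2.
by rewrite tensmxE !ord1 mxE mul1r; congr (A _ _); apply: val_inj.
Qed.

(** * Tensor products of families of 2 x 2 matrices *)

(* Unlike [2 ^ n], [pow2 n.+1] is convertible to [2 * pow2 n]. *)
Fixpoint pow2 (n : nat) : nat := if n is k.+1 then (2 * pow2 k)%N else 1%N.

(** Indexing the factors by position allows products and transposes of [lambda_mx] and [rho_mx] to
    be computed factor by factor. *)
Fixpoint tensfun (R : nzRingType) (n : nat) (f : nat -> 'M[R]_2) : 'M[R]_(pow2 n) :=
  if n is k.+1 then f 0%N *t tensfun k (fun i => f i.+1) else 1%:M.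

Lemma eq_tensfun (R : nzRingType) (n : nat) (f g : nat -> 'M[R]_2) :
  (forall k, (k < n)%N -> f k = g k) -> tensfun n f = tensfun n g.
Proof.
elim: n f g => [|n IHn] f g eqfg //=; rewrite eqfg //.
by congr (_ *t _); apply: IHn => k ltkn; apply: eqfg.
Qed.

Lemma tensfun_mul (R : comNzRingType) (n : nat) (f g : nat -> 'M[R]_2) :
  tensfun n f *m tensfun n g = tensfun n (fun k => f k *m g k).
Proof.
elim: n f g => [|n IHn] f g /=; first by rewrite mul1mx.
by rewrite tensmx_mul IHn.
Qed.

Lemma trmx_tensfun (R : nzRingType) (n : nat) (f : nat -> 'M[R]_2) :
  (tensfun n f)^T = tensfun n (fun k => (f k)^T).
Proof.
elim: n f => [|n IHn] f /=; first by rewrite trmx1.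
by rewrite trmx_tens IHn.
Qed.

Lemma tensfunZ (R : comNzRingType) (n : nat) (c : nat -> R) (f : nat -> 'M[R]_2) :
  tensfun n (fun k => c k *: f k) = (\prod_(k < n) c k) *: tensfun n f.
Proof.
elim: n c f => [|n IHn] c f /=; first by rewrite big_ord0 scale1r.
rewrite big_ord_recl (IHn (fun k => c k.+1)) /=.
by apply/matrixP => i j; rewrite !mxE mulrACA.
Qed.

Lemma sqmx_tensfunD (R : nzRingType) (m p : nat) (f : nat -> 'M[R]_2) :
  sqmx (tensfun (m + p) f) =
  sqmx (tensfun m f *t tensfun p (fun k => f (m + k)%N)).
Proof.
elim: m f => [|m IHm] f; first by rewrite sqmx_1tens.
by rewrite addSn /= sqmx_tensA; apply: sqmx_tens.
Qed.

Lemma sqmx_ntens (R : nzRingType) (n : nat) (A : 'M[R]_2) :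
  sqmx (A ^t n) = sqmx (tensfun n (fun=> A)).
Proof.
(* [A ^t 1] is [A] itself, while [tensfun] ends in a 1 x 1 identity. *)
case: n => [//|n]; elim: n => [|n IHn]; first by rewrite /= sqmx_tens1.
by rewrite ntensmxSS; apply: sqmx_tens.
Qed.

Lemma sqmx_tens_at (R : nzRingType) (i p : nat) (A B C : 'M[R]_2) :
  sqmx (A ^t i *t B *t C ^t p) =
  sqmx (tensfun (i + p).+1
          (fun k => if (k < i)%N then A else if k == i then B else C)).
Proof.
rewrite -addnS sqmx_tensfunD sqmx_tensA; apply: sqmx_tens.
  rewrite sqmx_ntens; congr sqmx; apply: eq_tensfun => k ltki.
  by rewrite ltki.
rewrite /= addn0 ltnn eqxx; apply: sqmx_tens => //.
rewrite sqmx_ntens; congr sqmx; apply: eq_tensfun => k _.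
by rewrite addnS ltnNge -addnS leq_addr /= -{2}[i]addn0 eqn_add2l.
Qed.

(** By multilinearity the signs [c k] of the factors come out as their product, so antisymmetric
    factors may cancel in pairs. *)
Lemma tensfun_sym (R : comNzRingType) (n : nat) (c : nat -> R) (f : nat -> 'M[R]_2) :
  (forall k, (k < n)%N -> (f k)^T = c k *: f k) -> \prod_(k < n) c k = 1 ->
  (tensfun n f)^T = tensfun n f.
Proof.
move=> fT c1; rewrite trmx_tensfun (@eq_tensfun _ _ _ (fun k => c k *: f k)) //.
by rewrite tensfunZ c1 scale1r.
Qed.

(** * Symmetry of the matrices [A_mx] *)

Definition lambda_fun (R : realType) (i k : nat) : 'M[R]_2 :=
  if (k < i)%N then sigma2 R else if k == i then J2 R else I2 R.

Definition rho_fun (R : realType) (i k : nat) : 'M[R]_2 :=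
  if (k < i)%N then I2 R else if k == i then J2 R else sigma2 R.

(** A factor is antisymmetric only where [J2] meets [I2], at positions [i] and [j] when [i < j]. For
    [j < i], [J2] meets [sigma2] there, and the product is symmetric because the two anticommute;
    for [i = j] the factor is the square of [J2]. *)
Lemma lambda_rho_fun_tr (R : realType) (i j k : nat) :
  (lambda_fun R i k *m rho_fun R j k)^T =
  (if (i < j)%N && ((k == i) || (k == j)) then - 1 else 1) *:
  (lambda_fun R i k *m rho_fun R j k).
Proof.
rewrite /lambda_fun /rho_fun; apply/matrixP => a b.
case: (ltngtP k i) => ki; case: (ltngtP k j) => kj;
  case: (ltngtP i j) => ij; try (exfalso; lia); rewrite /= ?orbT /=;
  rewrite !mxE !big_ord_recl !big_ord0 !mxE /=;
  case: a => -[|[|//]] ?; case: b => -[|[|//]] ? /=; ring.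
Qed.

Lemma lambda_rho_sym (R : realType) (n : nat) (i j : 'I_n.+1) :
  (lambda_mx R i *m rho_mx R j)^T = lambda_mx R i *m rho_mx R j.
Proof.
have em : (pow2 n.+1 = 2 ^ n.+1)%N.
  by elim: n.+1 => [//|k IHk]; rewrite expnS -IHk.
have lE : lambda_mx R i = castmx (em, em) (tensfun n.+1 (lambda_fun R i)).
  apply: sqmx_inj; rewrite !sqmx_cast sqmx_tens_at subnKC //.
  by rewrite -ltnS ltn_ord.
have rE : rho_mx R j = castmx (em, em) (tensfun n.+1 (rho_fun R j)).
  apply: sqmx_inj; rewrite !sqmx_cast sqmx_tens_at subnKC //.
  by rewrite -ltnS ltn_ord.
have -> : lambda_mx R i *m rho_mx R j = castmx (em, em)
    (tensfun n.+1 (fun k => lambda_fun R i k *m rho_fun R j k)).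
  by rewrite lE rE -tensfun_mul castmx_mulmx.
rewrite trmx_cast; congr (castmx _ _).
apply: tensfun_sym => [k _|]; first exact: lambda_rho_fun_tr.
have [ltij|_] := ltnP i j; last by rewrite big1.
(* The signs [- 1] at the two distinct positions [i] and [j] cancel. *)
have neji : j != i by rewrite -val_eqE neq_ltn ltij orbT.
rewrite (bigD1 i) //= (bigD1 j) //= !eqxx orbT big1 ?mulr1 ?mulrNN ?mulr1 //.
by move=> k /andP[/negPf ki /negPf kj]; rewrite !val_eqE ki kj.
Qed.

Lemma A_mx_sym (R : realType) (n : nat) (i j : 'I_n.+1) :
  (A_mx R i j)^T = A_mx R i j.
Proof.
rewrite /A_mx linearN /= -(mulmxA _ (lambda_mx R i)) !trmx_mul trmxK.
by rewrite -trmx_mul lambda_rho_sym !mulmxA.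
Qed.

Lemma calA_adj_sym (R : realType) (n : nat) (D : 'M[R]_n.+1) :
  (calA_adj D)^T = calA_adj D.
Proof.
rewrite /calA_adj linear_sum; apply: eq_bigr => i _ /=.
rewrite linear_sum; apply: eq_bigr => j _ /=.
by rewrite linearZ /= A_mx_sym.
Qed.

(** * The Frobenius inner product *)

Lemma mxdotE (R : realType) (m p : nat) (A B : 'M[R]_(m, p)) :
  mxdot A B = \sum_i \sum_j A i j * B i j.
Proof.
rewrite /mxdot exchange_big; apply: eq_bigr => j _ /=.
by rewrite mxE; apply: eq_bigr => i _; rewrite mxE.
Qed.

Lemma mxdotC (R : realType) (m p : nat) (A B : 'M[R]_(m, p)) :
  mxdot A B = mxdot B A.
Proof. by rewrite /mxdot -mxtrace_tr trmx_mul trmxK. Qed.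

Lemma mxdotDr (R : realType) (m p : nat) (A B C : 'M[R]_(m, p)) :
  mxdot A (B + C) = mxdot A B + mxdot A C.
Proof. by rewrite /mxdot mulmxDr mxtraceD. Qed.

Lemma mxdotZr (R : realType) (m p : nat) (a : R) (A B : 'M[R]_(m, p)) :
  mxdot A (a *: B) = a * mxdot A B.
Proof. by rewrite /mxdot -scalemxAr mxtraceZ. Qed.

Lemma mxdotDl (R : realType) (m p : nat) (A B C : 'M[R]_(m, p)) :
  mxdot (A + B) C = mxdot A C + mxdot B C.
Proof. by rewrite mxdotC mxdotDr !(mxdotC C). Qed.

Lemma mxdotZl (R : realType) (m p : nat) (a : R) (A B : 'M[R]_(m, p)) :
  mxdot (a *: A) B = a * mxdot A B.
Proof. by rewrite mxdotC mxdotZr mxdotC. Qed.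

Lemma mxdotNr (R : realType) (m p : nat) (A B : 'M[R]_(m, p)) :
  mxdot A (- B) = - mxdot A B.
Proof. by rewrite -scaleN1r mxdotZr mulN1r. Qed.

Lemma mxdotNl (R : realType) (m p : nat) (A B : 'M[R]_(m, p)) :
  mxdot (- A) B = - mxdot A B.
Proof. by rewrite mxdotC mxdotNr mxdotC. Qed.

Lemma mxdot_sumr (R : realType) (m p : nat) (I : finType) (A : 'M[R]_(m, p))
    (B : I -> 'M[R]_(m, p)) :
  mxdot A (\sum_i B i) = \sum_i mxdot A (B i).
Proof. by rewrite /mxdot mulmx_sumr raddf_sum. Qed.

Lemma mxdot_suml (R : realType) (m p : nat) (I : finType)
    (A : I -> 'M[R]_(m, p)) (B : 'M[R]_(m, p)) :
  mxdot (\sum_i A i) B = \sum_i mxdot (A i) B.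
Proof. by rewrite mxdotC mxdot_sumr; apply: eq_bigr => i _; rewrite mxdotC. Qed.

Lemma mxdot_ge0 (R : realType) (m p : nat) (A : 'M[R]_(m, p)) : 0 <= mxdot A A.
Proof.
by rewrite mxdotE; do 2!apply: sumr_ge0 => ? _; rewrite -expr2 sqr_ge0.
Qed.

Lemma mxdot_eq0 (R : realType) (m p : nat) (A : 'M[R]_(m, p)) :
  mxdot A A = 0 -> A = 0.
Proof.
rewrite mxdotE => A0; apply/matrixP => i j; rewrite mxE.
have {}A0 : \sum_j A i j * A i j = 0.
  apply: psumr_eq0P A0 _ _ => // k _.
  by apply: sumr_ge0 => ? _; rewrite -expr2 sqr_ge0.
have /eqP : A i j * A i j = 0.
  by apply: psumr_eq0P A0 _ _ => // k _; rewrite -expr2 sqr_ge0.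
by rewrite mulf_eq0 orbb => /eqP.
Qed.

Lemma mxdot_mulmxl (R : realType) (m p q : nat) (A : 'M[R]_(m, q))
    (B : 'M[R]_(m, p)) (C : 'M[R]_(p, q)) :
  mxdot A (B *m C) = mxdot (B^T *m A) C.
Proof. by rewrite /mxdot trmx_mul trmxK mulmxA. Qed.

Lemma mxdot_outer (R : realType) (m : nat) (A : 'M[R]_m) (x y : 'cV[R]_m) :
  mxdot A (x *m y^T) = mxdot x (A *m y).
Proof.
by rewrite /mxdot mulmxA mxtrace_mulC -mxtrace_tr !trmx_mul !trmxK mulmxA.
Qed.

Lemma tr_outer (R : realType) (m : nat) (x : 'cV[R]_m) :
  \tr (x *m x^T) = mxdot x x.
Proof. by rewrite mxtrace_mulC. Qed.

Lemma trE_mxdot (R : realType) (m : nat) (A : 'M[R]_m) (x : 'cV[R]_m) :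
  \tr (x^T *m A *m x) = mxdot x (A *m x).
Proof. by rewrite -mulmxA. Qed.

Lemma mxdot_col (R : realType) (m p q : nat) (A C : 'M[R]_(m, q))
    (B D : 'M[R]_(p, q)) :
  mxdot (col_mx A B) (col_mx C D) = mxdot A C + mxdot B D.
Proof. by rewrite /mxdot tr_col_mx mul_row_col mxtraceD. Qed.

Lemma mxdot_scalar (R : realType) (a b : R) :
  mxdot (a%:M : 'M_1) b%:M = a * b.
Proof. by rewrite /mxdot tr_scalar_mx mul_scalar_mx mxtraceZ mxtrace_scalar. Qed.

Lemma cV_dotE (R : realType) (m : nat) (x y : 'cV[R]_m) :
  x^T *m y = (mxdot x y)%:M.
Proof. by rewrite [LHS]mx11_scalar -trace_mx11. Qed.

(** * Factorization of positive semidefinite matrices *)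

Lemma affine_ge0_slope (R : realType) (a b : R) :
  (forall t : R, 0 <= b + t * a) -> a = 0.
Proof.
move=> ge0; have [//|a0] := eqVneq a 0.
(* At this [t] the affine function takes the value -1. *)
have := ge0 (- (b + 1) / a); rewrite divfK //; lra.
Qed.

(** Cholesky factorization by induction on the size. Either the corner entry [al] is 0, and then so
    is the column [b] below it, or the Schur complement [C - al^-1 *: (b *m b^T)] is again positive
    semidefinite. *)
Lemma psd_cholesky (R : realType) (m : nat) (Z : 'M[R]_m) :
  psd Z -> exists B : 'M[R]_m, Z = B^T *m B.
Proof.
elim: m Z => [|m IHm] Z.
  by move=> _; exists 0; apply/matrixP => -[].
rewrite -[m.+1]/(1 + m)%N in Z *; rewrite -[Z]submxK.
set a := ulsubmx Z; set b := dlsubmx Z; set C := drsubmx Z.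
move=> [Zsym Zpsd].
move: Zsym; rewrite tr_block_mx => /eq_block_mx[_ urE _ Csym].
rewrite -urE in Zpsd *.
pose al := a 0 0; have aE : a = al%:M by rewrite [LHS]mx11_scalar.
have formE (t : R) (y : 'cV[R]_m) :
    0 <= al * t ^+ 2 + t * mxdot b y *+ 2 + mxdot y (C *m y).
  have := Zpsd (col_mx t%:M y).
  rewrite trE_mxdot aE mul_block_col mxdot_col mxdotDr !mul_scalar_mx mul_mx_scalar.
  rewrite mxdotZr cV_dotE !mxdot_scalar mxdotDr mxdotZr (mxdotC y b).
  by congr (0 <= _); ring.
have [al0|al_neq0] := eqVneq al 0.
  have b0 : b = 0.
    (* With [al = 0], half the form at [(t, b)] is affine in [t] with slope [mxdot b b]. *)
    apply/mxdot_eq0/(@affine_ge0_slope _ _ (mxdot b (C *m b) / 2)) => t.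
    by have := formE t b; rewrite al0; lra.
  have [|B CE] := IHm C.
    split=> // y; rewrite trE_mxdot.
    by have := formE 0 y; rewrite expr2; lra.
  exists (block_mx 0 0 0 B).
  rewrite aE al0 b0 CE tr_block_mx mulmx_block !trmx0 !mul0mx !mulmx0 !addr0.
  by rewrite add0r raddf0.
have al_gt0 : 0 < al.
  rewrite lt0r al_neq0 /=; have := formE 1 0.
  by rewrite mulmx0 /mxdot !mulmx0 mxtrace0; lra.
have [|B CE] := IHm (C - al^-1 *: (b *m b^T)).
  split=> [|y]; first by rewrite linearB linearZ /= trmx_mul trmxK Csym.
  rewrite trE_mxdot mulmxBl -scalemxAl -mulmxA cV_dotE mul_mx_scalar.
  rewrite mxdotDr mxdotNr !mxdotZr (mxdotC y b).
  (* This [t] minimizes the form for fixed [y]; the minimum is the form of the Schur complement. *)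
  have := formE (- mxdot b y / al) y.
  by congr (0 <= _); field.
have Csum : C = al^-1 *: (b *m b^T) + B^T *m B by rewrite -CE addrC subrK.
pose s := Num.sqrt al.
have s0 : s != 0 by rewrite sqrtr_eq0 -ltNge.
have ss : s * s = al by rewrite -expr2 sqr_sqrtr // ltW.
exists (block_mx s%:M (s^-1 *: b^T) 0 B).
rewrite tr_block_mx mulmx_block !trmx0 !mul0mx !mulmx0 !addr0 tr_scalar_mx.
have -> : (s^-1 *: b^T)^T = s^-1 *: b by rewrite linearZ /= trmxK.
rewrite !mul_scalar_mx mul_mx_scalar -scalemxAl -scalemxAr !scalerA mulfV //.
rewrite !scale1r scale_scalar_mx ss -aE.
by rewrite -invfM ss -Csum.
Qed.

Lemma gram_outer (R : realType) (m p : nat) (B : 'M[R]_(p, m)) :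
  B^T *m B = \sum_(k < p) (row k B)^T *m ((row k B)^T)^T.
Proof.
apply/matrixP => i j; rewrite mxE summxE; apply: eq_bigr => k _.
by rewrite !mxE big_ord_recl big_ord0 addr0 !mxE.
Qed.

Lemma psd_sum_outer (R : realType) (m : nat) (Z : 'M[R]_m) :
  psd Z -> exists v : 'I_m -> 'cV[R]_m, Z = \sum_k v k *m (v k)^T.
Proof.
by move=> /psd_cholesky[B ->]; exists (fun k => (row k B)^T); apply: gram_outer.
Qed.

(** With [Z = B^T *m B], the form at [x] is the squared norm of [B *m x]. *)
Lemma psd_null (R : realType) (m : nat) (Z : 'M[R]_m) (x : 'cV[R]_m) :
  psd Z -> mxdot x (Z *m x) = 0 -> Z *m x = 0.
Proof.
move=> /psd_cholesky[B ->]; rewrite -mulmxA mxdot_mulmxl trmxK.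
by move=> /mxdot_eq0 ->; rewrite mulmx0.
Qed.

Lemma psd_outer (R : realType) (m : nat) (x : 'cV[R]_m) : psd (x *m x^T).
Proof.
split=> [|y]; first by rewrite trmx_mul trmxK.
rewrite trE_mxdot -mulmxA cV_dotE mul_mx_scalar mxdotZr (mxdotC y).
by rewrite -expr2 sqr_ge0.
Qed.

(** * Quadratic forms and the largest eigenvalue *)

Lemma form_bound (R : realType) (m : nat) (A : 'M[R]_m) :
  exists2 c : R, 0 < c & forall x : 'cV[R]_m, mxdot x (A *m x) <= c * mxdot x x.
Proof.
(* The summand 1 keeps the bound positive, hence invertible, even when [A] is 0. *)
exists (1 + \sum_i \sum_j `|A i j|).
  by rewrite ltr_pwDl // sumr_ge0 // => i _; rewrite sumr_ge0.
move=> x; have xE : mxdot x x = \sum_i x i 0 ^+ 2.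
  by rewrite mxdotE; apply: eq_bigr => i _; rewrite big_ord1 expr2.
have le_x i : x i 0 ^+ 2 <= mxdot x x.
  by rewrite xE (bigD1 i) //= lerDl sumr_ge0 // => j _; rewrite sqr_ge0.
rewrite mulrDl mul1r; apply: ler_wpDl; first exact: mxdot_ge0.
rewrite mxdotE mulr_suml; apply: ler_sum => i _; rewrite big_ord1 mxE.
rewrite mulr_sumr mulr_suml; apply: ler_sum => j _.
rewrite mulrCA; apply: le_trans (ler_norm _) _; rewrite normrM.
apply: ler_wpM2l => //; rewrite ler_norml.
(* The absolute value of [x i 0 * x j 0] is at most half the sum of the two squares, each at most
   [mxdot x x]. *)
have := le_x i; have := le_x j.
have := sqr_ge0 (x i 0 - x j 0); have := sqr_ge0 (x i 0 + x j 0).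
by rewrite !expr2 => *; apply/andP; split; nra.
Qed.

Lemma psd_shift_form (R : realType) (m : nat) (M : 'M[R]_m) (a : R) (x : 'cV[R]_m) :
  mxdot x ((a%:M - M) *m x) = a * mxdot x x - mxdot x (M *m x).
Proof. by rewrite mulmxBl mul_scalar_mx mxdotDr mxdotNr mxdotZr. Qed.

Lemma psd_shift (R : realType) (m : nat) (M : 'M[R]_m) (a : R) :
  M^T = M ->
  psd (a%:M - M) <-> forall x : 'cV[R]_m, mxdot x (M *m x) <= a * mxdot x x.
Proof.
move=> Msym; split=> [[_ ge0] x|le_a].
  by have := ge0 x; rewrite trE_mxdot psd_shift_form subr_ge0.
split=> [|x]; first by rewrite linearB /= tr_scalar_mx Msym.
by rewrite trE_mxdot psd_shift_form subr_ge0.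
Qed.

Lemma mxdot_gt0 (R : realType) (m p : nat) (A : 'M[R]_(m, p)) :
  A != 0 -> 0 < mxdot A A.
Proof.
move=> A0; rewrite lt0r mxdot_ge0 andbT.
by apply: contraNneq A0 => /mxdot_eq0 ->.
Qed.

(* The infimum [t] of the upper bounds of the Rayleigh quotient is an
   eigenvalue: otherwise [t%:M - M] is positive definite and [t] can be
   lowered. *)
Lemma largest_eigenvalue_psd (R : realType) (m : nat) (M : 'M[R]_m) (nu : R) :
  M^T = M -> largest_eigenvalue M nu -> psd (nu%:M - M).
Proof.
move=> Msym [/eigenvalueP[v _ v0] nu_max].
pose E : set R := [set a | forall x : 'cV[R]_m, mxdot x (M *m x) <= a * mxdot x x].
have [c _ cE] := form_bound M.
have v_gt0 : 0 < mxdot v^T v^T by rewrite mxdot_gt0 // trmx_eq0.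
have infE : has_inf E.
  split; first by exists c.
  exists (mxdot v^T (M *m v^T) / mxdot v^T v^T) => a Ea.
  by rewrite ler_pdivrMr.
pose t := inf E.
have tE : E t.
  move=> x; have [->|x0] := eqVneq x 0.
    by rewrite /mxdot !mulmx0 mxtrace0 mulr0.
  rewrite -ler_pdivrMr ?mxdot_gt0 //; apply: lb_le_inf; first by exists c.
  by move=> a Ea; rewrite ler_pdivrMr ?mxdot_gt0.
(* Then [t <= nu] by maximality of [nu], so [nu] is an upper bound as well. *)
suff t_eig : eigenvalue M t.
  apply/(psd_shift _ Msym) => x; apply: le_trans (tE x) _.
  by apply: ler_wpM2r; [exact: mxdot_ge0|exact: nu_max].
apply/contraT => t_eig; exfalso.
have [B tB] := psd_cholesky ((psd_shift _ Msym).2 tE).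
(* As [t] is assumed not to be an eigenvalue, [t%:M - M] is invertible, and so is its factor [B]. *)
have Bunit : B \in unitmx.
  have : t%:M - M \in unitmx.
    rewrite -opprB -scaleN1r unitmxZ ?unitrN1 //.
    by rewrite -row_free_unit -kermx_eq0; move: t_eig; rewrite /eigenvalue negbK.
  by rewrite tB unitmx_mul => /andP[].
(* At [B *m x] this bound reads [mxdot x x <= d * (t * mxdot x x - mxdot x (M *m x))], which puts
   [t - d^-1] in [E]. *)
have [d d0 dE] := form_bound ((invmx B)^T *m invmx B).
have : E (t - d^-1).
  move=> x; have := dE (B *m x).
  rewrite -mulmxA mxdot_mulmxl trmxK mulKmx //.
  have -> : mxdot (B *m x) (B *m x) = t * mxdot x x - mxdot x (M *m x).
    by rewrite -psd_shift_form tB -mulmxA [RHS]mxdot_mulmxl trmxK.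
  rewrite -ler_pdivrMl // mulrBl; lra.
move=> /(ge_inf infE.2); rewrite -/t; have := invr_gt0 d; rewrite d0; lra.
Qed.

(** * The convex hull of the rotations and its extreme points *)

Lemma conv_hull_subset (R : realType) (V : lmodType R) (S : set V) :
  S `<=` conv_hull S.
Proof.
move=> x Sx; exists 1%N, (fun=> 1), (fun=> x).
by split=> //; rewrite big_ord1 ?scale1r.
Qed.

(** The cross terms of the expanded squares add up to [- 2 * mxdot X X]. If the weights are
    nonnegative and no [Y i] has larger norm than [X], the right-hand side is at most 0, so every
    [Y i] of positive weight equals [X]. *)
Lemma conv_variance (R : realType) (m p k : nat) (w : 'I_k -> R)
    (Y : 'I_k -> 'M[R]_(m, p)) (X : 'M[R]_(m, p)) :
  \sum_i w i = 1 -> X = \sum_i w i *: Y i ->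
  \sum_i w i * mxdot (Y i - X) (Y i - X) =
  \sum_i w i * mxdot (Y i) (Y i) - mxdot X X.
Proof.
move=> w1 XE.
transitivity (\sum_i (w i * mxdot (Y i) (Y i) - 2 * mxdot (w i *: Y i) X
                      + w i * mxdot X X)).
  apply: eq_bigr => i _.
  by rewrite !(mxdotDr, mxdotDl, mxdotNr, mxdotNl) mxdotZl (mxdotC X); ring.
rewrite big_split sumrB /= -mulr_sumr -mulr_suml w1 -mxdot_suml -XE; ring.
Qed.

Lemma SO_norm (R : realType) (n : nat) (Q : 'M[R]_n) :
  SO R n Q -> mxdot Q Q = n%:R.
Proof. by case=> QQ _; rewrite /mxdot QQ mxtrace1. Qed.

(** The variance of rotations about their barycentre [X] is nonnegative. *)
Lemma conv_SO_norm (R : realType) (n : nat) (X : 'M[R]_n) :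
  conv_hull (SO R n) X -> mxdot X X <= n%:R.
Proof.
move=> [k [w [Y [w0 w1 SOY XE]]]].
rewrite -subr_ge0; have -> : n%:R = \sum_i w i * mxdot (Y i) (Y i).
  under eq_bigr => i _ do rewrite (SO_norm (SOY i)).
  by rewrite -mulr_suml w1 mul1r.
rewrite -(conv_variance w1 XE); apply: sumr_ge0 => i _.
by rewrite mulr_ge0 ?mxdot_ge0.
Qed.

(* [SO] lies on a Frobenius sphere, whose points are extreme in the ball. *)
Lemma SO_extreme (R : realType) (n k : nat) (w : 'I_k -> R) (Y : 'I_k -> 'M[R]_n)
    (Q : 'M[R]_n) (i : 'I_k) :
  SO R n Q -> (forall j, 0 <= w j) -> \sum_j w j = 1 ->
  (forall j, conv_hull (SO R n) (Y j)) -> Q = \sum_j w j *: Y j ->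
  w i != 0 -> Y i = Q.
Proof.
move=> SOQ w0 w1 convY QE wi.
have ge0 j : 0 <= w j * mxdot (Y j - Q) (Y j - Q).
  by rewrite mulr_ge0 ?mxdot_ge0.
have /psumr_eq0P /(_ i isT) /eqP : \sum_j w j * mxdot (Y j - Q) (Y j - Q) = 0.
  (* The variance is at most 0, since every [Y j] has squared norm at most [n%:R], the squared norm
     of [Q]. *)
  apply/eqP; rewrite eq_le sumr_ge0 // andbT (conv_variance w1 QE) (SO_norm SOQ).
  rewrite subr_le0 -[leRHS]mul1r -[X in X * _]w1 mulr_suml; apply: ler_sum => j _.
  by rewrite ler_wpM2l // conv_SO_norm.
move=> /(_ (fun j _ => ge0 j)).
by rewrite mulf_eq0 (negPf wi) /= => /eqP /mxdot_eq0 /eqP; rewrite subr_eq0 => /eqP.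
Qed.

(** * Linear optimization over the spectrahedron *)

Lemma mxdot_calA (R : realType) (n : nat) (D : 'M[R]_n.+1) (Z : 'M[R]_(2 ^ n)) :
  mxdot D (calA Z) = mxdot (calA_adj D) Z.
Proof.
rewrite mxdotE /calA_adj mxdot_suml; apply: eq_bigr => i _.
by rewrite mxdot_suml; apply: eq_bigr => j _; rewrite mxE mxdotZl.
Qed.

Lemma calA_sum (R : realType) (n : nat) (I : finType) (Z : I -> 'M[R]_(2 ^ n)) :
  calA (\sum_i Z i) = \sum_i calA (Z i).
Proof.
apply/matrixP => i j; rewrite summxE mxE mxdot_sumr.
by apply: eq_bigr => k _; rewrite mxE.
Qed.

Lemma calAZ (R : realType) (n : nat) (a : R) (Z : 'M[R]_(2 ^ n)) :
  calA (a *: Z) = a *: calA Z.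
Proof. by apply/matrixP => i j; rewrite !mxE mxdotZr. Qed.

(** Weak duality: for [Z] a sum of [v k *m (v k)^T], the gap is the sum of the forms of [a%:M - M]
    at the [v k]. *)
Lemma psd_tr_le (R : realType) (m : nat) (M Z : 'M[R]_m) (a : R) :
  psd (a%:M - M) -> psd Z -> mxdot M Z <= a * \tr Z.
Proof.
move=> [_ Npsd] /psd_sum_outer[v ->].
rewrite mxdot_sumr raddf_sum mulr_sumr; apply: ler_sum => k _ /=.
rewrite mxdot_outer tr_outer -subr_ge0 -psd_shift_form.
by have := Npsd (v k); rewrite trE_mxdot.
Qed.

(** Complementary slackness: when the gap is 0, each of its nonnegative terms vanishes, and
    [psd_null] puts [v k] in the kernel of [a%:M - M]. *)
Lemma psd_tr_eq (R : realType) (m : nat) (M Z : 'M[R]_m) (a : R) :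
  psd (a%:M - M) -> psd Z -> mxdot M Z = a * \tr Z ->
  exists2 v : 'I_m -> 'cV[R]_m,
    forall k, M *m v k = a *: v k & Z = \sum_k v k *m (v k)^T.
Proof.
move=> Npsd /psd_sum_outer[v ->]; rewrite mxdot_sumr raddf_sum mulr_sumr.
move=> tr_eq; exists v => // k.
have ge0 j : 0 <= mxdot (v j) ((a%:M - M) *m v j).
  by have := Npsd.2 (v j); rewrite trE_mxdot.
have /psumr_eq0P /(_ k isT) : \sum_j mxdot (v j) ((a%:M - M) *m v j) = 0.
  under eq_bigr => j _ do rewrite psd_shift_form -tr_outer -mxdot_outer.
  by rewrite sumrB tr_eq subrr.
move=> /(_ (fun j _ => ge0 j)) /(psd_null Npsd)/eqP.
by rewrite mulmxBl mul_scalar_mx subr_eq0 => /eqP.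
Qed.

(** * Unit eigenvectors *)

Lemma unit_eigenvector_normalize (R : realType) (m : nat) (M : 'M[R]_m) (a : R)
    (v : 'cV[R]_m) :
  M *m v = a *: v -> v != 0 ->
  exists2 mu, unit_eigenvector M a mu & v *m v^T = mxdot v v *: (mu *m mu^T).
Proof.
move=> Mv v0; have v_gt0 := mxdot_gt0 v0.
pose s := Num.sqrt (mxdot v v).
have s0 : s != 0 by rewrite sqrtr_eq0 -ltNge.
have ss : s * s = mxdot v v by rewrite -expr2 sqr_sqrtr // ltW.
exists (s^-1 *: v).
  split; first by rewrite -scalemxAr Mv !scalerA mulrC.
  by rewrite cV_dotE mxdotZl mxdotZr -ss mulKf // mulVf.
have -> : (s^-1 *: v)^T = s^-1 *: v^T by rewrite linearZ.
by rewrite -scalemxAl -scalemxAr !scalerA -ss mulfK // mulfV // scale1r.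
Qed.

Lemma unit_eigenvector_exists (R : realType) (m : nat) (M : 'M[R]_m) (a : R) :
  M^T = M -> eigenvalue M a -> exists mu, unit_eigenvector M a mu.
Proof.
move=> Msym /eigenvalueP[v Mv v0].
have [||mu mu_eig _] := @unit_eigenvector_normalize _ _ M a v^T.
- by rewrite -{1}Msym -trmx_mul Mv linearZ.
- by rewrite trmx_eq0.
- by exists mu.
Qed.

Lemma eigenspace_rank1 (R : realType) (m : nat) (M : 'M[R]_m) (a : R)
    (mu v : 'cV[R]_m) :
  M^T = M -> \rank (eigenspace M a) = 1%N -> unit_eigenvector M a mu ->
  M *m v = a *: v -> exists c, v = c *: mu.
Proof.
move=> Msym rk1 [Mmu mu1] Mv.
have inE (x : 'cV[R]_m) : M *m x = a *: x -> (x^T <= eigenspace M a)%MS.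
  by move=> Mx; apply/eigenspaceP; rewrite -{1}Msym -trmx_mul Mx linearZ.
have mu0 : mu^T != 0.
  apply: contra_eq_neq mu1 => ->; rewrite mul0mx eq_sym.
  by apply/eqP => /matrixP/(_ 0 0)/eqP; rewrite !mxE oner_eq0.
(* The eigenspace has rank 1 and contains the nonzero row [mu^T], which thus spans it. *)
have sub : (eigenspace M a <= mu^T)%MS.
  by rewrite -(mxrank_leqif_sup (inE _ Mmu)) rk1 rank_rV mu0.
have /sub_rVP[c vE] := submx_trans (inE _ Mv) sub.
by exists c; rewrite -[v]trmxK vE linearZ /= trmxK.
Qed.

(** A multiple [nu] can leave many maximizers (the whole convex hull when [D] is 0). The formula
    therefore takes two forms: each optimal rotation comes from some [mu], and for a simple [nu]
    every [mu] yields the one optimal point, a rotation. *)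
Theorem lemma2 (R : realType) (n : nat)
  (* Saunderson-Parrilo-Willsky *)
  (conv_SO : conv_hull (SO R n.+1) =
     [set calA Z | Z in [set Z : 'M[R]_(2 ^ n) | psd Z /\ \tr Z = 1]])
  (D : 'M[R]_n.+1) (nu : R)
  (nu_max : largest_eigenvalue (calA_adj D) nu) :
  [/\ forall mu : 'cV[R]_(2 ^ n), unit_eigenvector (calA_adj D) nu mu ->
        optimal D (calA (mu *m mu^T)),
      exists2 Rs : 'M[R]_n.+1, SO R n.+1 Rs & optimal D Rs,
      forall Rs : 'M[R]_n.+1, SO R n.+1 Rs -> optimal D Rs ->
        exists2 mu : 'cV[R]_(2 ^ n), unit_eigenvector (calA_adj D) nu mu &
          Rs = calA (mu *m mu^T)
    & \rank (eigenspace (calA_adj D) nu) = 1%N ->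
      forall mu : 'cV[R]_(2 ^ n), unit_eigenvector (calA_adj D) nu mu ->
        SO R n.+1 (calA (mu *m mu^T)) /\
        forall Rs : 'M[R]_n.+1, optimal D Rs -> Rs = calA (mu *m mu^T)].

Proof.
set M := calA_adj D in nu_max *.
have Msym : M^T = M := calA_adj_sym D.
have Npsd : psd (nu%:M - M) := largest_eigenvalue_psd Msym nu_max.
have conv_calA mu : unit_eigenvector M nu mu ->
    conv_hull (SO R n.+1) (calA (mu *m mu^T)).
  move=> [_ mu1]; rewrite conv_SO; exists (mu *m mu^T) => //.
  by split; [exact: psd_outer|rewrite mxtrace_mulC mu1 mxtrace1].
have value mu : unit_eigenvector M nu mu -> mxdot D (calA (mu *m mu^T)) = nu.
  move=> [Mmu mu1]; rewrite mxdot_calA mxdot_outer Mmu mxdotZr.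
  by rewrite /mxdot mu1 mxtrace1 mulr1.
have upper X : conv_hull (SO R n.+1) X -> mxdot D X <= nu.
  rewrite conv_SO => -[Z [Zpsd trZ] <-].
  by rewrite mxdot_calA -[leRHS]mulr1 -trZ psd_tr_le.
have opt mu : unit_eigenvector M nu mu -> optimal D (calA (mu *m mu^T)).
  move=> mu_eig; split; first exact: conv_calA.
  by move=> X /upper; rewrite value.
have [mu0 mu0_eig] := unit_eigenvector_exists Msym nu_max.1.
have opt_value Rs : optimal D Rs -> mxdot D Rs = nu.
  move=> [Rs_conv Rs_max]; apply/eqP; rewrite eq_le upper //=.
  by rewrite -(value _ mu0_eig) Rs_max //; exact: conv_calA.
have opt_decomp Rs : optimal D Rs ->
    exists2 v : 'I_(2 ^ n) -> 'cV[R]_(2 ^ n),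
      forall k, M *m v k = nu *: v k &
      Rs = \sum_k calA (v k *m (v k)^T) /\ \sum_k mxdot (v k) (v k) = 1.
  move=> Rs_opt; have := opt_value _ Rs_opt.
  have := Rs_opt.1; rewrite conv_SO => -[Z [Zpsd trZ] <-].
  rewrite mxdot_calA -[RHS]mulr1 -trZ => /(psd_tr_eq Npsd Zpsd)[v Mv ZE].
  exists v => //; split; first by rewrite -calA_sum -ZE.
  by rewrite ZE raddf_sum; apply: eq_bigr => k _ /=; rewrite tr_outer.
(* The point given by [mu0] has value [nu] and averages rotations of value at most [nu]; those of
   nonzero weight attain [nu]. *)
have ex_SO : exists2 Rs : 'M[R]_n.+1, SO R n.+1 Rs & optimal D Rs.
  have [[k [w [Y [w0 w1 SOY XE]]]] _] := opt _ mu0_eig.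
  have conv_SOY i : conv_hull (SO R n.+1) (Y i) by exact/conv_hull_subset/SOY.
  have le_nu i : mxdot D (Y i) <= nu by exact/upper/conv_SOY.
  have [i wi] : exists i, w i != 0.
    apply/existsP; rewrite -negb_forall; apply: contra_eqN w1 => /forallP w_0.
    by rewrite big1 ?(eq_sym 0) ?oner_eq0 // => i _; exact/eqP/w_0.
  have ge0 j : 0 <= w j * (nu - mxdot D (Y j)) by rewrite mulr_ge0 ?subr_ge0.
  have /psumr_eq0P /(_ i isT) : \sum_j w j * (nu - mxdot D (Y j)) = 0.
    under eq_bigr => j _ do rewrite mulrBr -mxdotZr.
    by rewrite sumrB -mulr_suml w1 mul1r -mxdot_sumr -XE value ?subrr.
  move=> /(_ (fun j _ => ge0 j)) /eqP.
  rewrite mulf_eq0 (negPf wi) subr_eq0 /= => /eqP nuE.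
  exists (Y i) => //; split; first exact: conv_SOY.
  by move=> X /upper; rewrite nuE.
split=> //.
- move=> Rs Rs_SO /opt_decomp[v Mv [RsE v1]].
  have [k vk0] : exists k, v k != 0.
    apply/existsP; rewrite -negb_forall; apply: contra_eqN v1 => /forallP v0.
    rewrite big1 ?(eq_sym 0) ?oner_eq0 // => i _.
    by rewrite (eqP (v0 i)) /mxdot mulmx0 mxtrace0.
  (* The points of conv(SO) that [Rs] is the combination of, with weights
     |v_j|^2; [Rs] itself is a filler where the weight is 0. *)
  pose Y j := if v j == 0 then Rs
              else (mxdot (v j) (v j))^-1 *: calA (v j *m (v j)^T).
  have [mu mu_eig muE] := unit_eigenvector_normalize (Mv k) vk0.
  exists mu => //.
  (* Where [v j] is nonzero, its squared norm cancels and [Y j] is the point of the normalized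
     eigenvector. *)
  have YE j (x : 'cV_(2 ^ n)) : v j != 0 ->
      v j *m (v j)^T = mxdot (v j) (v j) *: (x *m x^T) -> Y j = calA (x *m x^T).
    move=> vj0 vE; rewrite /Y (negPf vj0) vE calAZ scalerA mulVf ?scale1r //.
    by rewrite gt_eqF ?mxdot_gt0.
  rewrite -(YE k mu vk0 muE); apply/esym.
  apply: (@SO_extreme _ _ _ (fun j => mxdot (v j) (v j))) => //.
  + by move=> j; exact: mxdot_ge0.
  + move=> j; have [vj0|vj0] := eqVneq (v j) 0.
      by rewrite /Y vj0 eqxx; exact: conv_hull_subset.
    have [mu' mu'_eig mu'E] := unit_eigenvector_normalize (Mv j) vj0.
    by rewrite (YE j mu' vj0 mu'E); exact: conv_calA.
  + rewrite RsE; apply: eq_bigr => j _; rewrite /Y.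
    have [->|vj0] := eqVneq (v j) 0.
      rewrite mul0mx -[X in calA X](scale0r 0) calAZ /mxdot mulmx0 mxtrace0.
      by rewrite !scale0r.
    by rewrite scalerA mulfV ?scale1r // gt_eqF ?mxdot_gt0.
  + by rewrite gt_eqF ?mxdot_gt0.
- move=> rk1 mu mu_eig.
  have uniq Rs : optimal D Rs -> Rs = calA (mu *m mu^T).
    move=> /opt_decomp[v Mv [-> v1]].
    (* Each [v k] is some [c *: mu], so each term is [c * c] times the same point; these factors are
       the squared norms, whose sum is 1. *)
    rewrite -[RHS]scale1r -v1 scaler_suml; apply: eq_bigr => k _.
    have [c ->] := eigenspace_rank1 Msym rk1 mu_eig (Mv k).
    have -> : (c *: mu)^T = c *: mu^T by rewrite linearZ.
    rewrite -scalemxAl -scalemxAr scalerA calAZ mxdotZl mxdotZr.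
    by rewrite {1}/mxdot mu_eig.2 mxtrace1 mulr1.
  (* By uniqueness the optimal rotation already found is this point. *)
  have [Rs Rs_SO Rs_opt] := ex_SO.
  by split=> //; rewrite -(uniq _ Rs_opt).
Qed.
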